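(* Let $S=\{v_1,\ldots,v_n\}\subset\mathbb Z^n$ be an orthogonal subset with $p_4(S)=I(S)=n$, and let $B=\begin{bmatrix}v_1&\cdots&v_n\end{bmatrix}$. Then, up to a change of basis of $\mathbb Z^n$ and reordering or negating columns of $B$, $B$ is a block diagonal matrix each of whose blocks either is one of $$\begin{bmatrix}1&1&1&1&0&0&0&0\\1&-1&-1&-1&0&0&0&0\\0&1&-1&-1&1&0&0&0\\0&-1&1&1&1&0&0&0\\0&0&1&-1&0&1&1&0\\0&0&-1&1&0&1&-1&0\\0&0&1&-1&0&0&-1&1\\0&0&-1&1&0&0&1&1\end{bmatrix},\qquad \begin{bmatrix}1&1&1&1&0&0&0&0\\1&-1&-1&-1&0&0&0&0\\0&-1&1&0&1&1&0&0\\0&1&-1&0&1&-1&0&0\\0&1&0&-1&0&1&1&0\\0&-1&0&1&0&-1&1&0\\0&0&-1&1&0&1&0&1\\0&0&1&-1&0&-1&0&1\end{bmatrix},$$ or has the property that each of its columns has precisely four nonzero entries, each equal to $1$ or $-1$.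
   Context: $\mathbb Z^n$ carries the standard dot product with standard basis $e_1,\ldots,e_n$. For $S=\{v_1,\ldots,v_n\}$ let $a_i=\langle v_i,v_i\rangle$, $I(S)=\sum_{i=1}^n(a_i-3)$, $E_j=\{i:\langle v_i,e_j\rangle\ne0\}$, $\mathcal P_i=\{j:|E_j|=i\}$, $p_i(S)=|\mathcal P_i|$ (so $p_4(S)=n$ means every row of $B$ has exactly four nonzero entries). $S$ is orthogonal if $a_i\ge1$ for all $i$ and $\langle v_i,v_j\rangle=0$ for $i\ne j$. A change of basis of $\mathbb Z^n$ means replacing the standard basis by another orthonormal basis (a signed permutation of coordinates). *)

(* Defs.v *)
From mathcomp Require Import all_boot all_order all_algebra all_fingroup.
Set Implicit Arguments. Unset Strict Implicit. Unset Printing Implicit Defensive.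
Import Order.TTheory GRing.Theory Num.Theory.
Local Open Scope ring_scope.

(* B : 'M[int]_n, column j of B is the vector v_j in Z^n. *)

Definition coldot (n : nat) (B : 'M[int]_n) (i j : 'I_n) : int :=
  \sum_(k < n) B k i * B k j.

Definition orthogonal_cols (n : nat) (B : 'M[int]_n) : Prop :=
  (forall i, 1 <= coldot B i i) /\ (forall i j, i != j -> coldot B i j = 0).

Definition Iinv (n : nat) (B : 'M[int]_n) : int :=
  \sum_(i < n) (coldot B i i - 3).

Definition Erow (n : nat) (B : 'M[int]_n) (j : 'I_n) : {set 'I_n} :=
  [set i | B j i != 0].

Definition pcount (n : nat) (B : 'M[int]_n) (k : nat) : nat :=
  #|[set j : 'I_n | #|Erow B j| == k]|.

(* B' is obtained from B by a change of orthonormal basis of Z^n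
   (signed permutation of the coordinates = rows) and by reordering
   and negating columns. *)
Definition signed_equiv (n : nat) (B B' : 'M[int]_n) : Prop :=
  exists (s t : 'S_n) (r c : 'I_n -> int),
    (forall i, r i = 1 \/ r i = -1) /\ (forall j, c j = 1 \/ c j = -1) /\
    (forall i j, B' i j = r i * c j * B (s i) (t j)).

Definition mx_of_rows (rows : seq (seq int)) : 'M[int]_8 :=
  \matrix_(i < 8, j < 8) nth 0 (nth [::] rows i) j.

Definition M1 : 'M[int]_8 := mx_of_rows
  [:: [:: 1;  1;  1;  1; 0; 0;  0; 0];
      [:: 1; -1; -1; -1; 0; 0;  0; 0];
      [:: 0;  1; -1; -1; 1; 0;  0; 0];
      [:: 0; -1;  1;  1; 1; 0;  0; 0];
      [:: 0;  0;  1; -1; 0; 1;  1; 0];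
      [:: 0;  0; -1;  1; 0; 1; -1; 0];
      [:: 0;  0;  1; -1; 0; 0; -1; 1];
      [:: 0;  0; -1;  1; 0; 0;  1; 1]].

Definition M2 : 'M[int]_8 := mx_of_rows
  [:: [:: 1;  1;  1;  1; 0;  0; 0; 0];
      [:: 1; -1; -1; -1; 0;  0; 0; 0];
      [:: 0; -1;  1;  0; 1;  1; 0; 0];
      [:: 0;  1; -1;  0; 1; -1; 0; 0];
      [:: 0;  1;  0; -1; 0;  1; 1; 0];
      [:: 0; -1;  0;  1; 0; -1; 1; 0];
      [:: 0;  0; -1;  1; 0;  1; 0; 1];
      [:: 0;  0;  1; -1; 0; -1; 0; 1]].

(* Block-diagonal structure: a nondecreasing block label f on indices
   (the same labelling for rows and columns, so diagonal blocks are square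
   and consist of consecutive indices); entries outside diagonal blocks
   vanish. *)
Definition block_labelling (n : nat) (B : 'M[int]_n) (f : 'I_n -> nat) : Prop :=
  (forall i j : 'I_n, (i <= j)%N -> (f i <= f j)%N) /\
  (forall i j : 'I_n, B i j != 0 -> f i = f j).

Definition block_is (n : nat) (B : 'M[int]_n) (f : 'I_n -> nat) (l : nat)
    (M : 'M[int]_8) : Prop :=
  #|[set i : 'I_n | f i == l]| = 8%N /\
  exists a : nat,
    (forall i : 'I_n, f i = l -> (a <= i < a + 8)%N) /\
    (forall i j : 'I_n, f i = l -> f j = l ->
       B i j = M (inord (i - a)) (inord (j - a))).

Definition block_four_units (n : nat) (B : 'M[int]_n) (f : 'I_n -> nat)
    (l : nat) : Prop :=
  forall j : 'I_n, f j = l ->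
    #|[set i : 'I_n | (f i == l) && (B i j != 0)]| = 4%N /\
    (forall i : 'I_n, f i = l -> B i j != 0 -> B i j = 1 \/ B i j = -1).

Definition good_block_diagonal (n : nat) (B : 'M[int]_n) : Prop :=
  exists f : 'I_n -> nat, block_labelling B f /\
    forall l : nat, (exists i : 'I_n, f i = l) ->
      block_is B f l M1 \/ block_is B f l M2 \/ block_four_units B f l.

(* Main.v *)
Require Import Defs.
From mathcomp Require Import all_boot all_order all_algebra all_fingroup.
From mathcomp Require Import zify ring lra.
Import Order.TTheory GRing.Theory Num.Theory.
Local Open Scope ring_scope.

(* Since every row has four nonzero entries and the squared entries sum to
   [4 n], all nonzero entries are 1 or -1.  Orthogonality of the columns [v_j]
   makes the rows orthonormal for the weights [1 / a_j], so the four column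
   norms met by a row satisfy [1/a + 1/b + 1/c + 1/d = 1]; a parity count shows
   that all norms are even, which leaves (4,4,4,4), (2,4,6,12), (2,4,8,8) and
   (2,6,6,6).  Orthogonality of a row to its neighbours rules out (2,4,6,12) and
   forces a row of type (2,4,8,8) or (2,6,6,6) into a copy of [M1] or [M2] that
   no other row or column meets.  Once these copies are split off, the remaining
   columns all have norm 4 and form a single block. *)

(** * Unit fractions *)

(** Clearing denominators in the weighted orthogonality of two rows gives an integer relation
    between four products in {-1, 0, 1}, with coefficients 4, 2, 1, 1 for type (2,4,8,8) and 3, 1,
    1, 1 for type (2,6,6,6). It has so few solutions that a row sharing one column with a known row
    must share others, with determined relative signs. The unit-fraction identity of that new row
    then yields the norms of its unknown columns, and each column of norm 2 supplies a second row
    with the same support. Alternating these steps, the growth stops at eight rows and eight columns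
    because each of these columns then meets as many known rows as its norm allows; this exhaustion
    is what isolates the copy from the rest of [B]. Signs are not normalized along the way, which
    would mean replacing [B] at each step: relative signs are recorded and assembled into row and
    column signs only at the end. *)

Lemma half_weight_signs (wx wy wz : rat) (ua ux uy uz : int) :
  0 < wx -> 0 < wy -> 0 < wz -> 2^-1 + wx + wy + wz = 1 ->
  ua = 1 \/ ua = -1 -> ux = 0 \/ ux = 1 \/ ux = -1 ->
  uy = 0 \/ uy = 1 \/ uy = -1 -> uz = 0 \/ uz = 1 \/ uz = -1 ->
  ua%:~R / 2 + ux%:~R * wx + uy%:~R * wy + uz%:~R * wz = 0 ->
  [/\ ux = - ua, uy = - ua & uz = - ua].
Proof.
have bound (w : rat) (u : int) : 0 < w -> u = 0 \/ u = 1 \/ u = -1 ->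
    [/\ - w <= u%:~R * w, u%:~R * w <= w, u%:~R * w <= - w -> u = -1
      & w <= u%:~R * w -> u = 1].
  by move=> w0 [|[]] ->; split=> [||H|H] //; first [lra | exfalso; lra].
(* The weights [wx], [wy], [wz] sum to 1/2, so the three last terms can cancel a term of size 1/2
   only if each of them is extreme. *)
move=> px py pz W ea /(bound _ _ px)[xl xu x1 x2] /(bound _ _ py)[yl yu y1 y2].
move=> /(bound _ _ pz)[zl zu z1 z2]; case: ea => -> S.
  by split; [apply: x1|apply: y1|apply: z1]; lra.
by rewrite opprK; split; [apply: x2|apply: y2|apply: z2]; lra.
Qed.

Lemma invn_le (k m : nat) : (0 < k <= m)%N -> m%:R^-1 <= k%:R^-1 :> rat.
Proof.
case/andP=> k0 km; have m0 := leq_trans k0 km.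
by rewrite lef_pV2 ?ler_nat // qualifE /= ltr0n.
Qed.

Lemma invn_inj (k m : nat) : m%:R^-1 = k%:R^-1 :> rat -> m = k.
Proof. by move/invr_inj/eqP; rewrite eqr_nat => /eqP. Qed.

(** The smaller denominator is at most 8, since otherwise the sum is at most 2/9; 2 and 4 already
    give too much, and evenness excludes the solution 5, 20. *)
Lemma egyptian2 (c d : nat) : (2 <= c <= d)%N -> ~~ odd c ->
  c%:R^-1 + d%:R^-1 = 4^-1 :> rat -> (c = 6 /\ d = 12 \/ c = 8 /\ d = 8)%N.
Proof.
case/andP=> c2 cd evc W.
have Dp : 0 < d%:R^-1 :> rat by rewrite invr_gt0 ltr0n; lia.
have Dc : d%:R^-1 <= c%:R^-1 :> rat by apply: invn_le; lia.
have c8 : (c <= 8)%N.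
  rewrite leqNgt; apply/negP => c9.
  have := invn_le 9 c; rewrite c9 => /(_ isT) H; lra.
move: c8 c2 evc W Dc {cd}.
case: c => [|[|[|[|[|[|[|[|[|c]]]]]]]]] // _ _ _ W Dc.
- exfalso; lra.
- exfalso; lra.
- by left; split=> //; apply: invn_inj; lra.
- by right; split=> //; apply: invn_inj; lra.
Qed.

(** If [a] is at least 4, all four fractions must equal 1/4. Otherwise [a] is 2 and the rest sums to
    1/2: [b] at least 6 forces three sixths, and [b = 4] leaves 1/4 for [c] and [d]. *)
Lemma egyptian4 (a b c d : nat) : (2 <= a <= b)%N -> (b <= c <= d)%N ->
  ~~ odd a -> ~~ odd b -> ~~ odd c ->
  a%:R^-1 + b%:R^-1 + c%:R^-1 + d%:R^-1 = 1 :> rat ->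
  [\/ [/\ a = 4, b = 4, c = 4 & d = 4]%N, [/\ a = 2, b = 4, c = 6 & d = 12]%N,
      [/\ a = 2, b = 4, c = 8 & d = 8]%N | [/\ a = 2, b = 6, c = 6 & d = 6]%N].
Proof.
case/andP=> a2 ab /andP[bc cd] eva evb evc W.
have Dp : 0 < d%:R^-1 :> rat by rewrite invr_gt0 ltr0n; lia.
have Cp : 0 < c%:R^-1 :> rat by rewrite invr_gt0 ltr0n; lia.
have [a3|a3] := leqP 4 a.
  have Ha := invn_le 4 a ltac:(lia); have Hb := invn_le 4 b ltac:(lia).
  have Hc := invn_le 4 c ltac:(lia); have Hd := invn_le 4 d ltac:(lia).
  by constructor 1; split; apply: invn_inj; lra.
have a_eq : a = 2%N by case: (a) a2 a3 eva => [|[|[|[]]]].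
subst a.
have b2 : (b != 2)%N by apply/eqP => b_eq; subst b; lra.
have [b7|b7] := leqP 6 b.
  have Hb := invn_le 6 b ltac:(lia).
  have Hc := invn_le 6 c ltac:(lia); have Hd := invn_le 6 d ltac:(lia).
  by constructor 4; split=> //; apply: invn_inj; lra.
have b_eq : b = 4%N by case: (b) ab b2 b7 evb => [|[|[|[|[|[]]]]]].
subst b; have [||[-> ->]|[-> ->]] := egyptian2 c d _ evc; first lia.
- lra.
- by constructor 2.
- by constructor 3.
Qed.

(** Two even denominators other than 2 contribute at most 1/2, so one of them is 2. Applied with [k]
    equal to 4 and 6 to the two unknown columns of a newly found row. *)
Lemma egyptian_pair (k c d : nat) : (0 < k)%N -> (2 <= c)%N -> (2 <= d)%N ->
  ~~ odd c -> ~~ odd d -> c%:R^-1 + d%:R^-1 = 2^-1 + k%:R^-1 :> rat ->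
  c = 2%N /\ d = k \/ c = k /\ d = 2%N.
Proof.
move=> k0 c2 d2 evc evd W.
have Kp : 0 < k%:R^-1 :> rat by rewrite invr_gt0 ltr0n.
have [c4|c4] := leqP 4 c; last first.
  have c_eq : c = 2%N by case: (c) c2 c4 evc => [|[|[|[]]]].
  by subst c; left; split=> //; apply: invn_inj; lra.
have Hc := invn_le 4 c ltac:(lia).
have [d4|d4] := leqP 4 d.
  have Hd := invn_le 4 d ltac:(lia); exfalso; lra.
have d_eq : d = 2%N by case: (d) d2 d4 evd => [|[|[|[]]]].
by subst d; right; split=> //; apply: invn_inj; lra.
Qed.

(** * Weighted orthogonality of the rows *)

Section UnitEntries.

Set Implicit Arguments.
Unset Strict Implicit.

Variables (n : nat) (B : 'M[int]_n).
Hypothesis orthB : orthogonal_cols B.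
Hypothesis unitB : forall i j, -1 <= B i j <= 1.
Hypothesis row4 : forall i, #|Erow B i| = 4%N.

Definition colset (j : 'I_n) : {set 'I_n} := [set i | B i j != 0].
Definition norm (j : 'I_n) : nat := #|colset j|.

(** A list rather than a set, so that the four columns can be named in an order suited to their
    norms. *)
Definition row_supp (i : 'I_n) (s : seq 'I_n) : Prop :=
  uniq s /\ forall j, (B i j != 0) = (j \in s).

Lemma entryP i j : B i j = 0 \/ B i j = 1 \/ B i j = -1.
Proof. by have := unitB i j; lia. Qed.

Lemma prod_bound i k j : -1 <= B i j * B k j <= 1.
Proof. by move: (entryP i j) (entryP k j) => [->|[->|->]] [->|[->|->]]. Qed.

Lemma sqr_entry i j : B i j * B i j = (B i j != 0)%:Z.
Proof.
by have [->|[->|->]] := entryP i j.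
Qed.

Lemma coldot_norm j : coldot B j j = (norm j)%:Z.
Proof.
rewrite /coldot /norm -sum1_card -[RHS]natz natr_sum [RHS]big_mkcond /=.
by apply: eq_bigr => k _; rewrite sqr_entry inE; case: eqP.
Qed.

Lemma norm_gt0 j : (0 < norm j)%N.
Proof. by have := orthB.1 j; rewrite coldot_norm; lia. Qed.

(* The columns of [B] are orthogonal, so [D^-1 B^T] is a left inverse of [B]
   for [D] the diagonal matrix of column norms; being also a right inverse, it
   makes the rows of [B] orthonormal for the weights [1 / norm j]. *)
Lemma row_orthonormal i k :
  \sum_j (B i j * B k j)%:~R / (norm j)%:R = (i == k)%:R :> rat.
Proof.
pose C : 'M[rat]_n := map_mx intr B.
pose D : 'M[rat]_n := \matrix_(j, i) ((B i j)%:~R / (norm j)%:R).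
have DC : D *m C = 1%:M.
  apply/matrixP => j l; rewrite !mxE.
  have -> : \sum_i D j i * C i l = (coldot B j l)%:~R / (norm j)%:R.
    rewrite /coldot rmorph_sum /= mulr_suml; apply: eq_bigr => m _.
    by rewrite !mxE rmorphM /= mulrAC.
  have [<-|nejl] := eqVneq j l; last by rewrite orthB.2 // mul0r.
  rewrite coldot_norm; have := norm_gt0 j.
  by rewrite -(ltr0n rat) => /lt0r_neq0 nz; rewrite divff.
have := mulmx1C DC => /matrixP /(_ i k); rewrite !mxE => <-.
by apply: eq_bigr => j _; rewrite !mxE rmorphM /= mulrA.
Qed.

Lemma row_supp_size i s : row_supp i s -> size s = 4%N.
Proof.
case=> us sE; rewrite -(row4 i) -(card_uniqP us); apply: eq_card => j.
by rewrite !inE sE.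
Qed.

Lemma sum_row_supp (R : nmodType) i s (F : 'I_n -> R) : row_supp i s ->
  (forall j, B i j = 0 -> F j = 0) -> \sum_j F j = \sum_(j <- s) F j.
Proof.
case=> us sE F0; rewrite [RHS]big_uniq //= [RHS]big_mkcond /=.
by apply: eq_bigr => j _; rewrite -sE; have [/F0|] := eqVneq.
Qed.

Lemma row_complete i s : uniq s -> (forall j, j \in s -> B i j != 0) ->
  exists2 t, row_supp i (s ++ t) & size (s ++ t) = 4%N.
Proof.
move=> us sB; pose t := [seq j <- enum 'I_n | (B i j != 0) && (j \notin s)].
have st : row_supp i (s ++ t).
  split=> [|j].
    rewrite cat_uniq us /= filter_uniq ?enum_uniq // andbT.
    by apply/hasPn => j; rewrite mem_filter => /andP[/andP[]].
  rewrite mem_cat mem_filter mem_enum inE andbT.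
  by case js: (j \in s); rewrite ?andbT //= sB.
by exists t; last exact: row_supp_size st.
Qed.

Lemma row_weight4 i x y z w : row_supp i [:: x; y; z; w] ->
  (norm x)%:R^-1 + (norm y)%:R^-1 + (norm z)%:R^-1 + (norm w)%:R^-1 = 1 :> rat.
Proof.
move=> Hs; have := row_orthonormal i i; rewrite (sum_row_supp Hs); last first.
  by move=> j ->; rewrite ?(mul0r, mulr0z).
have nz j : j \in [:: x; y; z; w] -> (B i j * B i j)%:~R = 1 :> rat.
  by rewrite -Hs.2 sqr_entry => ->.
rewrite !big_cons big_nil !nz ?inE ?eqxx ?orbT // !mul1r ?eqxx => E.
by rewrite -[RHS]E addr0 !addrA.
Qed.

Lemma row_orth4_rat {i k x y z w} : row_supp i [:: x; y; z; w] -> i != k ->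
  (B i x * B k x)%:~R / (norm x)%:R + (B i y * B k y)%:~R / (norm y)%:R
    + (B i z * B k z)%:~R / (norm z)%:R + (B i w * B k w)%:~R / (norm w)%:R
  = 0 :> rat.
Proof.
move=> Hs neik; have := row_orthonormal i k.
rewrite (sum_row_supp Hs); last by move=> j ->; rewrite ?(mul0r, mulr0z).
by rewrite (negPf neik) !big_cons big_nil addr0 !addrA.
Qed.

(** Integral form of the weighted orthogonality, within reach of [lia]: [L] is a common multiple of
    the four norms and each coefficient is [L] divided by the norm of its column. *)
Lemma row_orth4 {i k x y z w} (px py pz pw : nat) (L : nat) :
  row_supp i [:: x; y; z; w] -> i != k -> (0 < L)%N ->
  (px * norm x)%N = L -> (py * norm y)%N = L ->
  (pz * norm z)%N = L -> (pw * norm w)%N = L ->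
  px%:Z * (B i x * B k x) + py%:Z * (B i y * B k y)
    + pz%:Z * (B i z * B k z) + pw%:Z * (B i w * B k w) = 0.
Proof.
move=> Hs neik Lgt0 Ex Ey Ez Ew.
have := row_orth4_rat Hs neik.
have nL j (p : nat) : (p * norm j)%N = L ->
    (norm j)%:R^-1 = p%:R / L%:R :> rat.
  move=> pL; rewrite -pL natrM.
  have p0 : p%:R != 0 :> rat by rewrite pnatr_eq0; case: (p) pL Lgt0 => // <-.
  have n0 : (norm j)%:R != 0 :> rat by rewrite pnatr_eq0 -lt0n norm_gt0.
  by field; rewrite p0 n0.
rewrite (nL x px) // (nL y py) //.
rewrite (nL z pz) // (nL w pw) // !mulrA -!mulrDl => /eqP.
rewrite mulf_eq0 invr_eq0 pnatr_eq0 (gtn_eqF Lgt0) orbF => /eqP E.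
apply: (mulrIz (oner_neq0 rat)); rewrite -[RHS]E.
rewrite !rmorphD !rmorphM /= -!pmulrn; ring.
Qed.

(* Each of the [norm j] rows meeting column [j] has three further nonzero
   entries, while by orthogonality any other column meets column [j] in an
   even number of rows. *)
Lemma norm_even j : ~~ odd (norm j).
Proof.
have even_common l : l != j ->
    ~~ odd (\sum_k (B k j != 0%R) * (B k l != 0%R))%N.
  move=> nelj; have := orthB.2 l j nelj; rewrite /coldot => S0.
  (* Entries are 0, 1 or -1, so each product agrees modulo 2 with the indicator that it is nonzero;
     the number of common rows has the parity of the vanishing dot product. *)
  pose T : int := \sum_k (((B k j != 0%R) * (B k l != 0%R))%N%:R - B k l * B k j).
  suff : (2 %| T)%Z.
    by rewrite /T sumrB S0 subr0 -natr_sum !natz dvdzE dvdn2.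
  rewrite /T; apply: rpred_sum => k _.
  have [->|[->|->]] := entryP k l; have [->|[->|->]] // := entryP k j.
(* Double count of the pairs of a row meeting column [j] and a column met by that row: [norm j * 4]
   in all, of which [norm j] come from [l = j] and an even number from each other column. *)
have E : (\sum_l \sum_k (B k j != 0%R) * (B k l != 0%R) = norm j * 4)%N.
  rewrite exchange_big /= /norm -sum_nat_const [RHS]big_mkcond /=.
  apply: eq_bigr => k _; rewrite -big_distrr /= inE; case: eqP => //= _.
  rewrite mul1n -(row4 k) -sum1_card [RHS]big_mkcond /=.
  by apply: eq_bigr => l _; rewrite inE; case: eqP.
have Ej : (\sum_k (B k j != 0%R) * (B k j != 0%R) = norm j)%N.
  rewrite /norm -sum1_card [RHS]big_mkcond /=.
  by apply: eq_bigr => k _; rewrite inE; case: eqP.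
move: E; rewrite (bigD1 j) //= Ej => E.
have : ~~ odd (\sum_(l < n | l != j) \sum_k (B k j != 0%R) * (B k l != 0%R))%N.
  elim/big_rec: _ => // l x nelj; rewrite oddD => evx.
  by rewrite (negPf (even_common l nelj)).
move: E; set s := (\sum_(l < n | _) _)%N => /(congr1 odd).
by rewrite oddD oddM andbF => + /negPf evs; rewrite evs addbF => ->.
Qed.

Lemma norm_ge2 j : (2 <= norm j)%N.
Proof. by have := norm_even j; have := norm_gt0 j; case: (norm j) => [|[]]. Qed.

Lemma new_row j (s : seq 'I_n) : (size s < norm j)%N ->
  exists2 k, B k j != 0 & k \notin s.
Proof.
move=> lts; have [/exists_inP[k]|H] := boolP [exists k in colset j, k \notin s].
  by rewrite inE => kj ks; exists k.
have : (norm j <= #|s|)%N.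
  apply: subset_leq_card; apply/subsetP => k kj.
  by move: H; rewrite negb_exists_in => /forall_inP /(_ k kj); rewrite negbK.
by move=> /leq_trans /(_ (card_size s)); rewrite leqNgt lts.
Qed.

Lemma col_full j (s : seq 'I_n) k : uniq s -> size s = norm j ->
  (forall i, i \in s -> B i j != 0) -> B k j != 0 -> k \in s.
Proof.
move=> us sz sB kj.
have /eqP E : [set i in s] == colset j.
  rewrite eqEcard; apply/andP; split.
    by apply/subsetP => i; rewrite !inE; apply: sB.
  by rewrite -[#|colset j|]/(norm j) -sz -(card_uniqP us) (cardsE (mem s)).
by have := kj; rewrite -[_ != 0](in_set (fun i => B i j != 0)) -/(colset j) -E inE.
Qed.

Lemma row_supp_full i s : uniq s -> size s = 4%N ->
  (forall j, j \in s -> B i j != 0) -> row_supp i s.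
Proof.
move=> us s4 sB; have [t Ht] := row_complete us sB.
by rewrite size_cat s4; case: t Ht => // Ht _; rewrite cats0 in Ht.
Qed.

Lemma row_supp_perm i s t : perm_eq s t -> row_supp i s -> row_supp i t.
Proof.
move=> st [us sE]; split=> [|j]; first by rewrite -(perm_uniq st).
by rewrite -(perm_mem st).
Qed.

(** A nonzero entry squares to 1, so [B i j * B k j] is the relative sign of the two rows at column
    [j]. *)
Lemma entry_rel i k j : B i j != 0 -> B k j = B i j * B k j * B i j.
Proof. by have [->|[->|->]] := entryP i j => // _; ring. Qed.

(* The two rows meeting a column of norm 2 already carry weight [1/2] there, so
   the other three products must all have the opposite sign. *)
Lemma partner_row m a x y z :
  row_supp m [:: a; x; y; z] -> norm a = 2%N ->
  exists m' e, [/\ m' != m, e = 1 \/ e = -1, row_supp m' [:: a; x; y; z]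
    & [/\ B m' a = e * B m a, B m' x = - e * B m x,
          B m' y = - e * B m y & B m' z = - e * B m z]].
Proof.
move=> Hm na2; have [m' m'a] : exists2 m', B m' a != 0 & m' \notin [:: m].
  by apply: new_row; rewrite na2.
rewrite inE => nem; exists m', (B m a * B m' a).
have Bm j : j \in [:: a; x; y; z] -> B m j != 0 by rewrite -Hm.2.
have [ma mx my mz] : [/\ B m a != 0, B m x != 0, B m y != 0 & B m z != 0].
  by split; apply: Bm; rewrite !inE eqxx ?orbT.
have e1 : B m a * B m' a = 1 \/ B m a * B m' a = -1.
  by move: (entryP m a) (entryP m' a) ma m'a => [->|[->|->]] [->|[->|->]]; auto.
have urel j : B m j * B m' j = 0 \/ B m j * B m' j = 1 \/ B m j * B m' j = -1.
  by have := prod_bound m m' j; lia.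
have O : m != m' by rewrite eq_sym.
have := row_orth4_rat Hm O; have := row_weight4 Hm; rewrite na2.
have pos j : 0 < (norm j)%:R^-1 :> rat by rewrite invr_gt0 ltr0n norm_gt0.
move=> W S; have [ux uy uz] := half_weight_signs _ _ _ _ _ _ _ (pos x) (pos y)
  (pos z) W e1 (urel x) (urel y) (urel z) S.
have Ba := entry_rel m' ma; have Bx := entry_rel m' mx.
have By := entry_rel m' my; have Bz := entry_rel m' mz.
split => //.
  apply: row_supp_full => [|//|j]; first exact: Hm.1.
  rewrite !inE => /or4P[] /eqP -> //.
  - by rewrite Bx ux; move: mx; case: e1 => ->; rewrite ?opprK ?mulN1r ?mul1r ?oppr_eq0.
  - by rewrite By uy; move: my; case: e1 => ->; rewrite ?opprK ?mulN1r ?mul1r ?oppr_eq0.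
  - by rewrite Bz uz; move: mz; case: e1 => ->; rewrite ?opprK ?mulN1r ?mul1r ?oppr_eq0.
by split; rewrite // -?ux // ux -?uy // uy -uz.
Qed.

Lemma row_types i : exists x y z w, row_supp i [:: x; y; z; w] /\
  [\/ [/\ norm x = 4, norm y = 4, norm z = 4 & norm w = 4]%N,
      [/\ norm x = 2, norm y = 4, norm z = 8 & norm w = 8]%N
    | [/\ norm x = 2, norm y = 6, norm z = 6 & norm w = 6]%N].
Proof.
have [//|t Ht t4] := @row_complete i [::] isT.
pose r := relpre norm leq; pose s := sort r t.
have ss : sorted r s by apply: sort_sorted => a b; apply: leq_total.
have Hs : row_supp i s by apply: row_supp_perm Ht; rewrite perm_sym /s perm_sort.
have s4 : size s = 4%N by rewrite /s size_sort.
clearbody s; case: s ss Hs s4 => [|x [|y [|z [|w []]]]] //= /and4P[xy yz zw _] Hs _.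
exists x, y, z, w; split=> //.
have [] := egyptian4 (norm x) (norm y) (norm z) (norm w); rewrite ?norm_even //.
- by rewrite norm_ge2.
- by apply/andP.
- exact: row_weight4 Hs.
- by constructor 1.
- case=> nx ny nz nw; exfalso.
  (* Type (2,4,6,12) has coefficients 6, 3, 2, 1. A row meeting [z] but not [y] would need 6u + 2v +
     w = 0 with v nonzero, impossible as 2v + w lies strictly between -6 and 6 and is nonzero. So
     the 6 rows of [z] would all be among the 4 rows of [y]. *)
  have : (norm z <= norm y)%N.
    apply: subset_leq_card; apply/subsetP => k; rewrite !inE => kz.
    have [<-|neik] := eqVneq i k; first by rewrite Hs.2 !inE eqxx orbT.
    have := row_orth4 (px := 6) (py := 3) (pz := 2) (pw := 1) (L := 12) Hs neik.
    rewrite nx ny nz nw => /(_ isT erefl erefl erefl erefl).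
    have : B i z * B k z != 0 by rewrite mulf_neq0 // Hs.2 !inE eqxx !orbT.
    have := prod_bound i k x; have := prod_bound i k z.
    have := prod_bound i k w; have [->|//] := eqVneq (B k y) 0.
    by rewrite mulr0; lia.
  by rewrite ny nz.
- by constructor 2.
- by constructor 3.
Qed.


(** * The exceptional blocks *)

Definition entry (L : seq (seq int)) (i j : nat) : int := nth 0 (nth [::] L i) j.

(** A copy of [L] on the listed rows and columns, up to the signs [sg] and [tu]. The last clause
    says that no nonzero entry links the copy to its complement, so it becomes a diagonal block
    after reordering. *)
Definition embeds_block x0 L (rs cs : seq 'I_n) (sg tu : seq int) : Prop :=
  [/\ [/\ uniq rs, uniq cs, size rs = 8%N & size cs = 8%N],
      [/\ size sg = 8%N, size tu = 8%N, forall e, e \in sg -> e = 1 \/ e = -1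
        & forall e, e \in tu -> e = 1 \/ e = -1],
      forall i j, (i < 8)%N -> (j < 8)%N ->
        B (nth x0 rs i) (nth x0 cs j) = nth 1 sg i * nth 1 tu j * entry L i j
    & forall k j, B k j != 0 -> (k \in rs) = (j \in cs)].

Definition rsupp L i := [seq t <- iota 0 8 | entry L i t != 0].
Definition csupp L j := [seq t <- iota 0 8 | entry L t j != 0].

(** Signs need checking only at the nonzero places of [L]: the row supports give the zeros and keep
    the rows inside [cs], and the column norms, equal to the column counts of [L], keep foreign rows
    out. *)
Lemma block_intro x0 L (rs cs : seq 'I_n) sg tu :
  uniq rs -> uniq cs -> size rs = 8%N -> size cs = 8%N ->
  size sg = 8%N -> size tu = 8%N -> (forall e, e \in sg -> e = 1 \/ e = -1) ->
  (forall e, e \in tu -> e = 1 \/ e = -1) ->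
  (forall i, (i < 8)%N ->
     row_supp (nth x0 rs i) [seq nth x0 cs t | t <- rsupp L i]) ->
  (forall i, (i < 8)%N -> forall t, t \in rsupp L i ->
     B (nth x0 rs i) (nth x0 cs t) = nth 1 sg i * nth 1 tu t * entry L i t) ->
  (forall j, (j < 8)%N -> norm (nth x0 cs j) = size (csupp L j)) ->
  embeds_block x0 L rs cs sg tu.
Proof.
move=> urs ucs rs8 cs8 sg8 tu8 sgP tuP Hrow Hent Hnorm.
have suppE i t : (t \in rsupp L i) = (t < 8)%N && (entry L i t != 0).
  by rewrite mem_filter mem_iota andbC.
have csuppE i t : (i \in csupp L t) = (i < 8)%N && (entry L i t != 0).
  by rewrite mem_filter mem_iota andbC.
have nz i t : (i < 8)%N -> (t < 8)%N ->
    (B (nth x0 rs i) (nth x0 cs t) != 0) = (entry L i t != 0).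
  move=> i8 t8; rewrite (Hrow i i8).2; apply/mapP/idP => [[t' t'L]|Lt].
    move/eqP; rewrite nth_uniq ?cs8 // => [/eqP ->|].
      by move: t'L; rewrite suppE => /andP[].
    by move: t'L; rewrite suppE => /andP[].
  by exists t => //; rewrite suppE t8.
split=> // [i j i8 j8|k j kj].
  have [L0|Ln0] := eqVneq (entry L i j) 0; last by apply: Hent; rewrite ?suppE ?j8.
  by apply/eqP; move: (nz i j i8 j8); rewrite L0 mulr0 eqxx => /negbFE.
apply/idP/idP => [/(nthP x0)[i]|/(nthP x0)[t]].
  rewrite rs8 => i8 ik; move: kj; rewrite -ik (Hrow i i8).2 => /mapP[t + ->].
  by rewrite suppE => /andP[t8 _]; rewrite mem_nth ?cs8.
rewrite cs8 => t8 tj.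
(* The pattern already supplies as many rows meeting this column as its norm, so [k] is one of
   them. *)
have : k \in [seq nth x0 rs i | i <- csupp L t].
  apply: (@col_full j); rewrite ?size_map -?tj ?Hnorm //; last by rewrite tj.
    rewrite map_inj_in_uniq ?filter_uniq ?iota_uniq // => i i'.
    rewrite !csuppE => /andP[i8 _] /andP[i'8 _] /eqP.
    by rewrite nth_uniq ?rs8 // => /eqP.
  by move=> i /mapP[i0 + ->]; rewrite csuppE => /andP[i8 Li]; rewrite nz.
case/mapP=> i + ->; rewrite csuppE => /andP[i8 _].
by rewrite mem_nth ?rs8.
Qed.

Lemma row_supp_nz i s j : row_supp i s -> j \in s -> B i j != 0.
Proof. by case=> _ ->. Qed.

Lemma sign_mul (e f : int) : e = 1 \/ e = -1 -> f = 1 \/ f = -1 ->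
  e * f = 1 \/ e * f = -1.
Proof. by move=> [->|->] [->|->]; auto. Qed.

Lemma sign_factor (e : int) i j : e = 1 \/ e = -1 -> B i j != 0 ->
  exists2 t : int, t = 1 \/ t = -1 & B i j = e * t.
Proof.
move=> se ij; exists (e * B i j); last by case: se => ->; ring.
by apply: sign_mul => //; have := entryP i j; move: ij; lia.
Qed.

Lemma nz_sign i j : B i j != 0 -> B i j = 1 \/ B i j = -1.
Proof. by have := entryP i j; lia. Qed.

Lemma row_extend2 k x y : x != y ->
  B k x != 0 -> B k y != 0 ->
  exists a b, [/\ row_supp k [:: a; x; y; b], ~~ odd (norm a), ~~ odd (norm b)
    & (norm a)%:R^-1 + (norm b)%:R^-1
      = 1 - (norm x)%:R^-1 - (norm y)%:R^-1 :> rat].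
Proof.
move=> nexy kx ky; have [||t Ht] := @row_complete k [:: x; y].
- by rewrite /= inE nexy.
- by move=> j; rewrite !inE => /orP[]/eqP->.
case: t Ht => [|a [|b []]] //= Ht _.
exists a, b; rewrite !norm_even; split=> //.
  by apply: row_supp_perm Ht; rewrite (perm_catCA [:: x; y] [:: a] [:: b]).
by have W := row_weight4 Ht; lra.
Qed.

Lemma neq_norm x y : norm x <> norm y -> x != y.
Proof. by move=> nn; apply/eqP => xy; rewrite xy in nn. Qed.

(* The rows [m, m', p, p'] are those meeting the column [b] of norm 4. *)
Lemma type1_half m a b c d : row_supp m [:: a; b; c; d] ->
  norm a = 2%N -> norm b = 4%N -> norm c = 8%N -> norm d = 8%N ->
  exists m' p p' a' (e e1 e2 : int),
  [/\ [/\ e = 1 \/ e = -1, e1 = 1 \/ e1 = -1 & e2 = 1 \/ e2 = -1],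
      [/\ row_supp m' [:: a; b; c; d], row_supp p [:: a'; b; c; d],
          row_supp p' [:: a'; b; c; d], norm a' = 2%N & a' != a]
    & [/\ uniq [:: m; m'; p; p'],
          [/\ B m' a = e * B m a, B m' b = - e * B m b,
              B m' c = - e * B m c & B m' d = - e * B m d],
          [/\ B p b = e1 * B m b, B p c = - e1 * B m c & B p d = - e1 * B m d]
        & [/\ B p' a' = e2 * B p a', B p' b = - e2 * B p b,
              B p' c = - e2 * B p c & B p' d = - e2 * B p d]]].
Proof.
move=> Hm na nb nc nd.
have [m' [e [nem' se Hm' Em']]] := partner_row Hm na.
have [p pb] : exists2 p, B p b != 0 & p \notin [:: m; m'].
  by apply: new_row; rewrite nb.
rewrite !inE negb_or => /andP[nepm nepm'].
have [ma [mb [mc md]]] : B m a != 0 /\ B m b != 0 /\ B m c != 0 /\ B m d != 0.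
  by split; [|split; [|split]]; apply: row_supp_nz Hm _; rewrite !inE eqxx ?orbT.
have pa : B p a = 0.
  apply/eqP/negPn/negP => pa.
  have : p \in [:: m; m'].
    apply: col_full pa => //; first by rewrite /= inE eq_sym nem'.
    by move=> i; rewrite !inE => /orP[]/eqP->; rewrite ?Hm'.2 ?Hm.2 !inE eqxx.
  by rewrite !inE (negPf nepm) (negPf nepm').
have nemp : m != p by rewrite eq_sym.
have := row_orth4 (px := 4) (py := 2) (pz := 1) (pw := 1) (L := 8) Hm nemp.
rewrite na nb nc nd pa mulr0 => /(_ isT erefl erefl erefl erefl) S.
(* With the term of [a] gone, the relation reads 2u + v + w = 0 with u = 1 or -1, which forces v = w
   = -u. *)
have ub0 : B m b * B p b != 0 by rewrite mulf_neq0.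
have [se1 uc ud] : [/\ B m b * B p b = 1 \/ B m b * B p b = -1,
    B m c * B p c = - (B m b * B p b) & B m d * B p d = - (B m b * B p b)].
  move: S ub0 (prod_bound m p b) (prod_bound m p c) (prod_bound m p d).
  by split; lia.
have [pc pd] : B p c != 0 /\ B p d != 0.
  by split; apply/eqP => p0; rewrite p0 in uc ud; lia.
have Ht : exists2 t, row_supp p ([:: b; c; d] ++ t) & size ([:: b; c; d] ++ t) = 4%N.
  apply: row_complete; first by case/andP: Hm.1.
  by move=> j; rewrite !inE => /or3P[]/eqP->.
case: Ht => [[|a' []]] //= Ht _.
(* The weights 1/4, 1/8, 1/8 of [b], [c], [d] leave 1/2. *)
have na' : norm a' = 2%N.
  by apply: invn_inj; have := row_weight4 Ht; rewrite nb nc nd => W; lra.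
have Hp : row_supp p [:: a'; b; c; d].
  by apply: row_supp_perm Ht; rewrite (perm_catC [:: b; c; d] [:: a']).
have nea : a' != a.
  by apply/eqP => aa; have := Hp.2 a; rewrite pa -aa !inE !eqxx.
have [p' [e2 [nep' se2 Hp' Ep']]] := partner_row Hp na'.
exists m', p, p', a', e, (B m b * B p b), e2; split=> //; split=> //.
  have ma' k : row_supp k [:: a; b; c; d] -> B k a' = 0.
    move=> Hk; apply/eqP/negPn; rewrite Hk.2 !inE (negPf nea) /=.
    by have := Hp.1; rewrite /= !inE => /andP[].
  have p'a' : B p' a' != 0 by rewrite Hp'.2 !inE eqxx.
  have nep'm : p' != m by apply/eqP => E; rewrite E ma' // eqxx in p'a'.
  have nep'm' : p' != m' by apply/eqP => E; rewrite E ma' // eqxx in p'a'.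
  rewrite /= !inE !negb_or [m == m']eq_sym [m == p]eq_sym [m == p']eq_sym.
  rewrite [m' == p]eq_sym [m' == p']eq_sym [p == p']eq_sym.
  by rewrite nem' nepm nepm' nep'm nep'm' nep'.
split; first exact: entry_rel.
  by rewrite -uc; apply: entry_rel.
by rewrite -ud; apply: entry_rel.
Qed.

Lemma col_zero j (s : seq 'I_n) k : uniq s -> size s = norm j ->
  (forall i, i \in s -> B i j != 0) -> k \notin s -> B k j = 0.
Proof.
move=> us sz sB ks; apply/eqP/negPn/negP => kj.
by rewrite (col_full us sz sB kj) in ks.
Qed.

(** The lists behind [M1] and [M2], kept apart from [mx_of_rows] so that [entry] computes at
    numerals. *)
Definition rows1 : seq (seq int) :=
  [:: [:: 1;  1;  1;  1; 0; 0;  0; 0];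
      [:: 1; -1; -1; -1; 0; 0;  0; 0];
      [:: 0;  1; -1; -1; 1; 0;  0; 0];
      [:: 0; -1;  1;  1; 1; 0;  0; 0];
      [:: 0;  0;  1; -1; 0; 1;  1; 0];
      [:: 0;  0; -1;  1; 0; 1; -1; 0];
      [:: 0;  0;  1; -1; 0; 0; -1; 1];
      [:: 0;  0; -1;  1; 0; 0;  1; 1]].

Definition rows2 : seq (seq int) :=
  [:: [:: 1;  1;  1;  1; 0;  0; 0; 0];
      [:: 1; -1; -1; -1; 0;  0; 0; 0];
      [:: 0; -1;  1;  0; 1;  1; 0; 0];
      [:: 0;  1; -1;  0; 1; -1; 0; 0];
      [:: 0;  1;  0; -1; 0;  1; 1; 0];
      [:: 0; -1;  0;  1; 0; -1; 1; 0];
      [:: 0;  0; -1;  1; 0;  1; 0; 1];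
      [:: 0;  0;  1; -1; 0; -1; 0; 1]].

(** The columns [c] and [d] meet eight rows, of which [type1_half] at [m] finds four. A fifth row
    [q] through [c] turns out to have type (2,4,8,8) with the same [c] and [d], and [type1_half] at
    [q] finds the other four. *)
Lemma type1_block m a b c d : row_supp m [:: a; b; c; d] ->
  norm a = 2%N -> norm b = 4%N -> norm c = 8%N -> norm d = 8%N ->
  exists rs cs sg tu, m \in rs /\ embeds_block m rows1 rs cs sg tu.
Proof.
move=> Hm na nb nc nd.
have [m' [p [p' [a2 [e1 [e2 [e3 [[s1 s2 s3] [Hm' Hp Hp' na2 nea2]]]]]]]]]
  := type1_half Hm na nb nc nd.
case=> ump Em' Ep Ep'.
have [q qc qmp] : exists2 q, B q c != 0 & q \notin [:: m; m'; p; p'].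
  by apply: new_row; rewrite nc.
have [nemm' nepp'] : m != m' /\ p != p'.
  by move: ump; rewrite /= !inE !negb_or => /and4P[/and3P[-> _ _] _ -> _].
have zb k : k \notin [:: m; m'; p; p'] -> B k b = 0.
  apply: col_zero => // i; rewrite !inE => /or4P[]/eqP->;
  by rewrite ?Hm.2 ?Hm'.2 ?Hp.2 ?Hp'.2 !inE eqxx orbT.
have za k : k \notin [:: m; m'; p; p'] -> B k a = 0.
  rewrite !inE !negb_or => /and4P[km km' _ _].
  apply: (@col_zero a [:: m; m']); rewrite /= ?inE ?negb_or ?nemm' ?km ?km' //.
  by move=> i; rewrite !inE => /orP[]/eqP->; rewrite ?Hm.2 ?Hm'.2 !inE eqxx.
have za2 k : k \notin [:: m; m'; p; p'] -> B k a2 = 0.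
  rewrite !inE !negb_or => /and4P[_ _ kp kp'].
  apply: (@col_zero a2 [:: p; p']); rewrite /= ?inE ?negb_or ?nepp' ?kp ?kp' //.
  by move=> i; rewrite !inE => /orP[]/eqP->; rewrite ?Hp.2 ?Hp'.2 !inE eqxx.
have nemq : m != q by move: qmp; rewrite !inE eq_sym => /norP[].
have := row_orth4 (px := 4) (py := 2) (pz := 1) (pw := 1) (L := 8) Hm nemq.
rewrite na nb nc nd (za q) // (zb q) // !mulr0 => /(_ isT erefl erefl erefl erefl) S.
have [mc md] : B m c != 0 /\ B m d != 0 by rewrite !Hm.2 !inE !eqxx !orbT.
(* As [q] misses both [a] and [b], only the products at [c] and [d] remain in the relation, and they
   cancel. *)
pose e4 : int := B m c * B q c.
have [s4 ud] : (e4 = 1 \/ e4 = -1) /\ B m d * B q d = - e4.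
  have : e4 != 0 by rewrite mulf_neq0.
  by move: S (prod_bound m q c); rewrite -/e4; lia.
have qcE : B q c = e4 * B m c by apply: entry_rel.
have qdE : B q d = - e4 * B m d by rewrite -ud; apply: entry_rel.
have qd : B q d != 0 by apply/eqP => q0; rewrite q0 mulr0 in ud; lia.
have necd : c != d by move: Hm.1; rewrite /= !inE => /and4P[_ _ ->].
(* The weight left to the two unknown columns of [q] is 1 - 1/8 - 1/8 = 1/2 + 1/4. *)
have [a3 [b2 [Hq na3 nb2]]] :
    exists a3 b2, [/\ row_supp q [:: a3; b2; c; d], norm a3 = 2%N & norm b2 = 4%N].
  have [x [y [Hq evx evy W]]] := row_extend2 necd qc qd.
  have [//|||//|//||[nx ny]|[nx ny]] := egyptian_pair 4 (norm x) (norm y).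
  - exact: norm_ge2.
  - exact: norm_ge2.
  - by rewrite W nc nd; lra.
  - by exists x, y; split=> //; apply: row_supp_perm Hq; apply/seq.permP => P /=; ring.
  - by exists y, x; split=> //; apply: row_supp_perm Hq; apply/seq.permP => P /=; ring.
have [q' [r [r' [a4 [e5 [e6 [e7 [[s5 s6 s7] [Hq' Hr Hr' na4 nea4]]]]]]]]]
  := type1_half Hq na3 nb2 nc nd.
case=> uqr Eq' Er Er'.
have qnz j : j \in [:: a3; b2; c; d] -> B q j != 0 by rewrite Hq.2.
have neb2b : b2 != b.
  by apply/eqP => E; have := qnz b2; rewrite !inE eqxx orbT E zb // eqxx => /(_ isT).
have nea3a : a3 != a.
  by apply/eqP => E; have := qnz a3; rewrite !inE eqxx E za // eqxx => /(_ isT).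
have nea3a2 : a3 != a2.
  by apply/eqP => E; have := qnz a3; rewrite !inE eqxx E za2 // eqxx => /(_ isT).
have [neb2c neb2d] : b2 != c /\ b2 != d.
  by move: Hq.1; rewrite /= !inE !negb_or => /and4P[_ /andP[-> ->]].
have neb2a : b2 != a by apply: neq_norm; rewrite nb2 na.
have neb2a2 : b2 != a2 by apply: neq_norm; rewrite nb2 na2.
(* The first four rows live on [a], [b], [c], [d], [a2], none of which is [b2]; since [q], [q'],
   [r], [r'] all meet [b2], they are new. *)
have znew k : B k b2 != 0 -> k \notin [:: m; m'; p; p'].
  apply: contraNN; rewrite !inE => /or4P[]/eqP->; apply/eqP/eqP;
  rewrite -[_ == 0]negbK ?Hm.2 ?Hm'.2 ?Hp.2 ?Hp'.2 !inE;
  by rewrite ?(negPf neb2a) ?(negPf neb2a2) (negPf neb2b) (negPf neb2c) (negPf neb2d).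
have rnew : r \notin [:: m; m'; p; p'].
  by apply: znew; rewrite Hr.2 !inE eqxx orbT.
have nea4a : a4 != a.
  by apply/eqP => E; have := Hr.2 a4; rewrite E za // !inE !eqxx.
have nea4a2 : a4 != a2.
  by apply/eqP => E; have := Hr.2 a4; rewrite E za2 // !inE !eqxx.
have urs : uniq [:: m; m'; p; p'; q; q'; r; r'].
  rewrite (cat_uniq [:: m; m'; p; p'] [:: q; q'; r; r']) ump uqr andbT.
  apply/hasPn => k kq; apply: znew; move: kq; rewrite !inE => /or4P[]/eqP->;
  by rewrite ?Hq.2 ?Hq'.2 ?Hr.2 ?Hr'.2 !inE eqxx orbT.
have ucs : uniq [:: a; b; c; d; a2; a3; b2; a4].
  have := Hm.1; have := Hp.1; have := Hq.1; have := Hr.1.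
  rewrite /= !inE !negb_or !andbT.
  move=> /and3P[/and3P[r1 r2 r3] _ _] /and3P[/and3P[q1 q2 q3] _ _].
  move=> /and3P[/and3P[p1 p2 p3] _ _] /and3P[/and3P[m1 m2 m3] /andP[m4 m5] m6].
  do !(apply/andP; split);
  first [assumption | by rewrite eq_sym
        | by apply: neq_norm; rewrite ?na ?nb ?nc ?nd ?na2 ?na3 ?nb2 ?na4].
have [t2 st2 t2E] := sign_factor s2 (row_supp_nz Hp (mem_head _ _)).
have [t3 st3 t3E] := sign_factor s4 (row_supp_nz Hq (mem_head _ _)).
have [|t5 st5 t5E] := @sign_factor e4 q b2 s4.
  by apply: qnz; rewrite !inE eqxx orbT.
have [|t4 st4 t4E] := sign_factor (e := - e6 * e4) _ (row_supp_nz Hr (mem_head _ _)).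
  by apply: sign_mul => //; case: s6 => ->; auto.
(* Giving [m] the sign 1 and [a], [b], [c], [d] the signs of its entries turns the first row into
   ones. The rows [p], [q], [r] take their signs from these columns, and the new columns take theirs
   from the row where they first occur. *)
exists [:: m; m'; p; p'; q; q'; r; r'], [:: a; b; c; d; a2; a3; b2; a4],
  [:: 1; e1; e2; e3 * e2; e4; e5 * e4; - e6 * e4; e7 * (- e6 * e4)],
  [:: B m a; B m b; B m c; B m d; t2; t3; t5; t4].
split; first exact: mem_head.
have s6' : - e6 = 1 \/ - e6 = -1 by case: s6 => ->; auto.
have s32 := sign_mul s3 s2; have s54 := sign_mul s5 s4.
have s64 := sign_mul s6' s4; have s764 := sign_mul s7 s64.
case: Em' Ep Ep' Eq' Er Er' => ? ? ? ? [? ? ?] [? ? ? ?] [? ? ? ?] [? ? ?] [? ? ? ?].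
apply: block_intro => //.
- by move=> e; rewrite !inE => /or4P[/eqP->|/eqP->|/eqP->|
    /or4P[/eqP->|/eqP->|/eqP->|/orP[]/eqP->]]; auto.
- move=> e; rewrite !inE => /or4P[/eqP->|/eqP->|/eqP->|
    /or4P[/eqP->|/eqP->|/eqP->|/orP[]/eqP->]] //;
  by apply: nz_sign; rewrite Hm.2 !inE eqxx ?orbT.
- case=> [|[|[|[|[|[|[|[|//]]]]]]]] _ /=.
  + exact: Hm.
  + exact: Hm'.
  + by apply: row_supp_perm Hp; apply/seq.permP => P /=; ring.
  + by apply: row_supp_perm Hp'; apply/seq.permP => P /=; ring.
  + by apply: row_supp_perm Hq; apply/seq.permP => P /=; ring.
  + by apply: row_supp_perm Hq'; apply/seq.permP => P /=; ring.
  + by apply: row_supp_perm Hr; apply/seq.permP => P /=; ring.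
  + by apply: row_supp_perm Hr'; apply/seq.permP => P /=; ring.
- case=> [|[|[|[|[|[|[|[|//]]]]]]]] _ t; rewrite /= !inE => /or4P[]/eqP->;
  rewrite /entry /=;
  repeat match goal with H : fun_of_matrix B _ _ = _ |- _ => rewrite {}H end; ring.
- by case=> [|[|[|[|[|[|[|[|//]]]]]]]] _.
Qed.

(** The relation has coefficients 3, 1, 1, 1 and its first term vanishes. Three products equal to 1
    or -1 cannot sum to 0, so exactly one of the products at [c] and [d] is nonzero, and it cancels
    the one at [b]. *)
Lemma type2_step m p a b c d : row_supp m [:: a; b; c; d] ->
  norm a = 2%N -> norm b = 6%N -> norm c = 6%N -> norm d = 6%N ->
  m != p -> B p a = 0 -> B p b != 0 ->
  [/\ B p c != 0, B p d = 0 & B m c * B p c = - (B m b * B p b)] \/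
  [/\ B p d != 0, B p c = 0 & B m d * B p d = - (B m b * B p b)].
Proof.
move=> Hm na nb nc nd nemp pa pb.
have := row_orth4 (px := 3) (py := 1) (pz := 1) (pw := 1) (L := 6) Hm nemp.
rewrite na nb nc nd pa mulr0 => /(_ isT erefl erefl erefl erefl).
have ub : B m b * B p b != 0 by rewrite mulf_neq0 ?Hm.2 // !inE eqxx orbT.
have [mc md] : B m c != 0 /\ B m d != 0 by rewrite !Hm.2 !inE !eqxx !orbT.
move: (prod_bound m p b) ub (prod_bound m p c) (prod_bound m p d).
have [pc|pc] := eqVneq (B p c) 0; have [pd|pd] := eqVneq (B p d) 0.
- by rewrite pc pd !mulr0; lia.
- by rewrite pc mulr0 => ? ? ? ? ?; right; split=> //; lia.
- by rewrite pd mulr0 => ? ? ? ? ?; left; split=> //; lia.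
have : B m c * B p c != 0 by rewrite mulf_neq0.
have : B m d * B p d != 0 by rewrite mulf_neq0.
by lia.
Qed.

Lemma row_extend3 k x y z : uniq [:: x; y; z] ->
  B k x != 0 -> B k y != 0 -> B k z != 0 ->
  norm x = 6%N -> norm y = 6%N -> norm z = 6%N ->
  exists2 a, row_supp k [:: a; x; y; z] & norm a = 2%N.
Proof.
move=> u kx ky kz nx ny nz.
have Ht : exists2 t, row_supp k ([:: x; y; z] ++ t) & size ([:: x; y; z] ++ t) = 4%N.
  by apply: row_complete => // j; rewrite !inE => /or3P[]/eqP->.
case: Ht => [[|a []]] //= Ht _; exists a.
  by apply: row_supp_perm Ht; rewrite (perm_catC [:: x; y; z] [:: a]).
by apply: invn_inj; have := row_weight4 Ht; rewrite nx ny nz => W; lra.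
Qed.

Lemma pair_zero j m m' k : m' != m -> norm j = 2%N -> B m j != 0 ->
  B m' j != 0 -> k != m -> k != m' -> B k j = 0.
Proof.
move=> ne nj mj m'j km km'; apply: (@col_zero j [:: m; m']).
- by rewrite /= inE eq_sym ne.
- by [].
- by move=> i; rewrite !inE => /orP[]/eqP->.
- by rewrite !inE (negPf km) (negPf km').
Qed.

(** The copy is governed by four columns [b], [c], [d], [e] of norm 6. Each of the four pairs of
    rows, headed by [m], [p], [q], [r], meets three of them and has a column of norm 2 to itself;
    the missed column is [e], [d], [c], [b] respectively. *)
Lemma type2_block m a b c d : row_supp m [:: a; b; c; d] ->
  norm a = 2%N -> norm b = 6%N -> norm c = 6%N -> norm d = 6%N ->
  exists rs cs sg tu, m \in rs /\ embeds_block m rows2 rs cs sg tu.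
Proof.
move=> Hm0 na nb nc0 nd0.
have ma : B m a != 0 by rewrite Hm0.2 mem_head.
have [p pb pa] : exists2 p, B p b != 0 & B p a = 0.
  have [|p pb] := @new_row b (enum (colset a)); first by rewrite -cardE -/(norm a) na nb.
  by rewrite mem_enum inE negbK => /eqP; exists p.
have nemp : m != p by apply/eqP => E; rewrite E pa eqxx in ma.
(* [c] and [d] play symmetric roles; they are renamed so that [p] meets [c] and misses [d]. *)
have [c' [d' [Hm nc nd [pc pd uc]]]] : exists c d,
    [/\ row_supp m [:: a; b; c; d], norm c = 6%N, norm d = 6%N
      & [/\ B p c != 0, B p d = 0 & B m c * B p c = - (B m b * B p b)]].
  case: (type2_step Hm0 na nb nc0 nd0 nemp pa pb) => H; first by exists c, d.
  exists d, c; split=> //; apply: row_supp_perm Hm0.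
  by apply/seq.permP => P /=; ring.
move: c' d' Hm nc nd pc pd uc {Hm0 nc0 nd0} => {}c {}d Hm nc nd pc pd uc.
have [mb [mc md]] : B m b != 0 /\ B m c != 0 /\ B m d != 0.
  by rewrite !Hm.2 !inE !eqxx !orbT.
have [nebc nebd necd] : [/\ b != c, b != d & c != d].
  by move: Hm.1; rewrite /= !inE !negb_or => /and4P[_ /andP[-> ->] ->].
have [m' [e1 [nem' s1 Hm' Em']]] := partner_row Hm na.
have m'a : B m' a != 0 by rewrite Hm'.2 mem_head.
have za k : k != m -> k != m' -> B k a = 0 by apply: pair_zero.
(* The weight left to the two unknown columns of [p] is 1 - 1/6 - 1/6 = 1/2 + 1/6. *)
have [a2 [e [Hp na2 ne]]] :
    exists a2 e, [/\ row_supp p [:: a2; b; c; e], norm a2 = 2%N & norm e = 6%N].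
  have [x [y [Hp evx evy W]]] := row_extend2 nebc pb pc.
  have [//|||//|//||[nx ny]|[nx ny]] := egyptian_pair 6 (norm x) (norm y).
  - exact: norm_ge2.
  - exact: norm_ge2.
  - by rewrite W nb nc; lra.
  - by exists x, y.
  - by exists y, x; split=> //; apply: row_supp_perm Hp; apply/seq.permP => P /=; ring.
have pa2 : B p a2 != 0 by rewrite Hp.2 mem_head.
have pe : B p e != 0 by rewrite Hp.2 !inE eqxx !orbT.
have ned : e != d by apply/eqP => E; rewrite E pd eqxx in pe.
have nea2 : a2 != a by apply/eqP => E; rewrite E pa eqxx in pa2.
have [nebe nece] : b != e /\ c != e.
  by move: Hp.1; rewrite /= !inE !negb_or => /and4P[_ /andP[_ ->] ->].
have [p' [e3 [nep' s3 Hp' Ep']]] := partner_row Hp na2.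
have p'a2 : B p' a2 != 0 by rewrite Hp'.2 mem_head.
have za2 k : k != p -> k != p' -> B k a2 = 0 by apply: pair_zero.
have p'a : B p' a = 0.
  by apply/eqP/negPn; rewrite Hp'.2 -Hp.2 pa eqxx.
have out k : B k a = 0 -> k != m /\ k != m'.
  by move=> k0; split; apply/eqP => E; [move: ma|move: m'a]; rewrite -E k0 eqxx.
have [pm pm'] := out p pa; have [p'm p'm'] := out p' p'a.
have umpb : uniq [:: m; m'; p; p'].
  rewrite /= !inE !negb_or [m == m']eq_sym [m == p]eq_sym [m == p']eq_sym.
  rewrite [m' == p]eq_sym [m' == p']eq_sym [p == p']eq_sym.
  by rewrite nem' pm pm' p'm p'm' nep'.
have [q qb] : exists2 q, B q b != 0 & q \notin [:: m; m'; p; p'].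
  by apply: new_row; rewrite nb.
rewrite !inE !negb_or => /and4P[qm qm' qp qp'].
have qa := za q qm qm'; have qa2 := za2 q qp qp'.
have nemq : m != q by rewrite eq_sym.
have nepq : p != q by rewrite eq_sym.
(* Against [m], the row [q] meets exactly one of [c], [d]; against [p], exactly one of [c], [e]. So
   it meets either [c] alone or both [d] and [e]. *)
have [qd qe qc ud ue] : [/\ B q d != 0, B q e != 0, B q c = 0,
    B m d * B q d = - (B m b * B q b) & B p e * B q e = - (B p b * B q b)].
  case: (type2_step Hm na nb nc nd nemq qa qb) => [][h1 h2 h3];
  case: (type2_step Hp na2 nb nc ne nepq qa2 qb) => [][h4 h5 h6] //; last first.
  - by rewrite h2 eqxx in h4.
  - by rewrite h5 eqxx in h1.
  (* [b] and [c] cannot have opposite relative signs in three pairs of rows *)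
  exfalso; move: uc h3 h6; have := nz_sign mb; have := nz_sign pb.
  have := nz_sign qb; have := nz_sign mc; have := nz_sign pc; have := nz_sign h1.
  by do 6!case=> ->.
have [|a3 Hq na3] := @row_extend3 q b d e _ qb qd qe nb nd ne.
  by rewrite /= !inE negb_or nebd nebe eq_sym ned.
have [q' [e5 [neq' s5 Hq' Eq']]] := partner_row Hq na3.
have qa3 : B q a3 != 0 by rewrite Hq.2 mem_head.
have q'a3 : B q' a3 != 0 by rewrite Hq'.2 mem_head.
have za3 k : k != q -> k != q' -> B k a3 = 0 by apply: pair_zero.
have zq' j : B q j = 0 -> B q' j = 0.
  by move=> q0; apply/eqP/negPn; rewrite Hq'.2 -Hq.2 q0 eqxx.
have out2 k : B k a2 = 0 -> k != p /\ k != p'.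
  by move=> k0; split; apply/eqP => E; [move: pa2|move: p'a2]; rewrite -E k0 eqxx.
have [q'm q'm'] := out q' (zq' a qa); have [q'p q'p'] := out2 q' (zq' a2 qa2).
have nea3a : a3 != a by apply/eqP => E; rewrite E qa eqxx in qa3.
have nea3a2 : a3 != a2 by apply/eqP => E; rewrite E qa2 eqxx in qa3.
have umq : uniq ([:: m; m'; p; p'] ++ [:: q; q']).
  rewrite cat_uniq umpb /= !inE !negb_or [q == q']eq_sym.
  by rewrite neq' qm qm' qp qp' q'm q'm' q'p q'p'.
have [r rc] : exists2 r, B r c != 0 & r \notin [:: m; m'; p; p'].
  by apply: new_row; rewrite nc.
rewrite !inE !negb_or => /and4P[rm rm' rp rp'].
have rq : r != q by apply/eqP => E; rewrite E qc eqxx in rc.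
have rq' : r != q' by apply/eqP => E; rewrite E zq' // eqxx in rc.
have ra := za r rm rm'; have ra2 := za2 r rp rp'; have ra3 := za3 r rq rq'.
(* The six rows found so far exhaust the column [b] of norm 6. *)
have rb : B r b = 0.
  apply: (@col_zero b _ _ umq); rewrite ?nb //.
    move=> i; rewrite mem_cat !inE => /orP[/or4P[]|/orP[]]/eqP->;
    by rewrite ?Hm'.2 ?Hp'.2 ?Hq'.2 ?inE ?eqxx ?orbT.
  rewrite mem_cat !inE !negb_or.
  by rewrite rm rm' rp rp' rq rq'.
have nemr : m != r by rewrite eq_sym.
have nepr : p != r by rewrite eq_sym.
have Hmc : row_supp m [:: a; c; b; d].
  by apply: row_supp_perm Hm; apply/seq.permP => P /=; ring.
have Hpc : row_supp p [:: a2; c; b; e].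
  by apply: row_supp_perm Hp; apply/seq.permP => P /=; ring.
have [rd re vd ve] : [/\ B r d != 0, B r e != 0,
    B m d * B r d = - (B m c * B r c) & B p e * B r e = - (B p c * B r c)].
  case: (type2_step Hmc na nc nb nd nemr ra rc) => [][h1 h2 h3].
    by rewrite rb eqxx in h1.
  case: (type2_step Hpc na2 nc nb ne nepr ra2 rc) => [][h4 h5 h6] //.
  by rewrite rb eqxx in h4.
have [|a4 Hr na4] := @row_extend3 r c d e _ rc rd re nc nd ne.
  by rewrite /= !inE negb_or necd nece eq_sym ned.
have [r' [e7 [ner' s7 Hr' Er']]] := partner_row Hr na4.
have ra4 : B r a4 != 0 by rewrite Hr.2 mem_head.
have zr' j : B r j = 0 -> B r' j = 0.
  by move=> r0; apply/eqP/negPn; rewrite Hr'.2 -Hr.2 r0 eqxx.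
have out3 k : B k a3 = 0 -> k != q /\ k != q'.
  by move=> k0; split; apply/eqP => E; [move: qa3|move: q'a3]; rewrite -E k0 eqxx.
have [r'm r'm'] := out r' (zr' a ra); have [r'p r'p'] := out2 r' (zr' a2 ra2).
have [r'q r'q'] := out3 r' (zr' a3 ra3).
have nea4a : a4 != a by apply/eqP => E; rewrite E ra eqxx in ra4.
have nea4a2 : a4 != a2 by apply/eqP => E; rewrite E ra2 eqxx in ra4.
have nea4a3 : a4 != a3 by apply/eqP => E; rewrite E ra3 eqxx in ra4.
have urs : uniq ([:: m; m'; p; p'; q; q'] ++ [:: r; r']).
  rewrite cat_uniq umq /= !inE !negb_or [r == r']eq_sym ner' rm rm' rp rp' rq rq'.
  by rewrite r'm r'm' r'p r'p' r'q r'q'.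
have ucs : uniq [:: a; b; c; d; a2; e; a3; a4].
  rewrite /= !inE !negb_or !andbT.
  do !(apply/andP; split);
  first [assumption | by rewrite eq_sym
        | by apply: neq_norm; rewrite ?na ?nb ?nc ?nd ?ne ?na2 ?na3 ?na4].
pose e2 : int := B m c * B p c; pose e4 : int := B m b * B q b.
pose e6 : int := B m d * B r d.
have s2 : e2 = 1 \/ e2 = -1 by apply: sign_mul; apply: nz_sign.
have s4 : e4 = 1 \/ e4 = -1 by apply: sign_mul; apply: nz_sign.
have s6 : e6 = 1 \/ e6 = -1 by apply: sign_mul; apply: nz_sign.
have pcE : B p c = e2 * B m c by apply: entry_rel.
have pbE : B p b = - e2 * B m b by rewrite /e2 uc opprK; apply: entry_rel.
have qbE : B q b = e4 * B m b by apply: entry_rel.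
have qdE : B q d = - e4 * B m d by rewrite /e4 -ud; apply: entry_rel.
have rdE : B r d = e6 * B m d by apply: entry_rel.
have rcE : B r c = - e6 * B m c by rewrite /e6 vd opprK; apply: entry_rel.
have [t2 st2 t2E] := sign_factor s2 pa2.
have [te ste teE] := sign_factor s2 pe.
have [t3 st3 t3E] := sign_factor s4 qa3.
have [t4 st4 t4E] := sign_factor s6 ra4.
(* The row [m] misses [e], so the sign of this column is fixed at [p], and the entries of [q] and
   [r] there must be compared with [p] instead of [m]. *)
have qeE : B q e = e4 * te.
  rewrite (entry_rel q pe) ue teE pbE qbE.
  by case: (nz_sign mb) => ->; case: s2 => ->; ring.
have reE : B r e = e6 * te.
  rewrite (entry_rel r pe) ve teE pcE rcE.
  by case: (nz_sign mc) => ->; case: s2 => ->; ring.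
have s32 := sign_mul s3 s2; have s54 := sign_mul s5 s4.
have s76 := sign_mul s7 s6.
exists [:: m; m'; p; p'; q; q'; r; r'], [:: a; b; c; d; a2; e; a3; a4],
  [:: 1; e1; e2; e3 * e2; e4; e5 * e4; e6; e7 * e6],
  [:: B m a; B m b; B m c; B m d; t2; te; t3; t4].
split; first exact: mem_head.
case: Em' Ep' Eq' Er' => ? ? ? ? [? ? ? ?] [? ? ? ?] [? ? ? ?].
apply: block_intro => //.
- by move=> x; rewrite !inE => /or4P[/eqP->|/eqP->|/eqP->|
    /or4P[/eqP->|/eqP->|/eqP->|/orP[]/eqP->]]; auto.
- move=> x; rewrite !inE => /or4P[/eqP->|/eqP->|/eqP->|
    /or4P[/eqP->|/eqP->|/eqP->|/orP[]/eqP->]] //;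
  exact: nz_sign.
- case=> [|[|[|[|[|[|[|[|//]]]]]]]] _ /=.
  + exact: Hm.
  + exact: Hm'.
  + by apply: row_supp_perm Hp; apply/seq.permP => P /=; ring.
  + by apply: row_supp_perm Hp'; apply/seq.permP => P /=; ring.
  + by apply: row_supp_perm Hq; apply/seq.permP => P /=; ring.
  + by apply: row_supp_perm Hq'; apply/seq.permP => P /=; ring.
  + by apply: row_supp_perm Hr; apply/seq.permP => P /=; ring.
  + by apply: row_supp_perm Hr'; apply/seq.permP => P /=; ring.
- case=> [|[|[|[|[|[|[|[|//]]]]]]]] _ t; rewrite /= !inE => /or4P[]/eqP->;
  rewrite /entry /=;
  repeat match goal with H : fun_of_matrix B _ _ = _ |- _ => rewrite {}H end; ring.
- by case=> [|[|[|[|[|[|[|[|//]]]]]]]] _.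
Qed.


(** * Block diagonal form *)

(** Both patterns are connected as bipartite graphs of rows and columns. Applied to membership in
    the rows and columns already extracted, this keeps a new copy from overlapping them
    partially. *)
Lemma block_connected L (f g : nat -> bool) : L = rows1 \/ L = rows2 ->
  (forall i j, (i < 8)%N -> (j < 8)%N -> entry L i j != 0 -> f i = g j) ->
  forall i, (i < 8)%N -> f i = f 0%N /\ g i = f 0%N.
Proof.
case=> -> H.
  (* Column 2 of [rows1] has no zero entry. *)
  have Hf i : (i < 8)%N -> f i = f 0%N.
    by case: i => [|[|[|[|[|[|[|[|//]]]]]]]] _; rewrite ?[LHS](H _ 2%N) // (H 0%N 2%N).
  move=> i i8; split; first exact: Hf.
  (* The list names, for each column, a row that meets it. *)
  rewrite -(Hf (nth 0 [:: 0; 0; 0; 0; 2; 4; 4; 6] i)%N); last first.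
    by case: i i8 => [|[|[|[|[|[|[|[|//]]]]]]]].
  by apply/esym; case: i i8 => [|[|[|[|[|[|[|[|//]]]]]]]] _; apply: H.
(* In [rows2] every row meets column 1 or column 2, and row 0 meets both. *)
have Hf i : (i < 8)%N -> f i = f 0%N.
  have E1 : f 0%N = g 1%N by apply: H.
  have E2 : f 0%N = g 2%N by apply: H.
  case: i => [|[|[|[|[|[|[|[|//]]]]]]]] _;
  by [|rewrite E1; apply: H|rewrite E2; apply: H].
move=> i i8; split; first exact: Hf.
rewrite -(Hf (nth 0 [:: 0; 0; 0; 0; 2; 2; 4; 6] i)%N); last first.
  by case: i i8 => [|[|[|[|[|[|[|[|//]]]]]]]].
by apply/esym; case: i i8 => [|[|[|[|[|[|[|[|//]]]]]]]] _; apply: H.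
Qed.

(** The copy with index [b] occupies positions [8 * b] to [8 * b + 7] of all four lists. The last
    clause keeps the rest of [B] disconnected from the extracted part, so that extraction can
    continue. *)
Definition partial_blocks x0 K (rs cs : seq 'I_n) (sg tu : seq int) : Prop :=
  [/\ [/\ uniq rs, uniq cs, size rs = (8 * K)%N & size cs = (8 * K)%N],
      [/\ size sg = (8 * K)%N, size tu = (8 * K)%N,
          forall e, e \in sg -> e = 1 \/ e = -1
        & forall e, e \in tu -> e = 1 \/ e = -1],
      forall b, (b < K)%N -> exists2 L, L = rows1 \/ L = rows2 &
        forall i j, (i < 8)%N -> (j < 8)%N ->
          B (nth x0 rs (8 * b + i)) (nth x0 cs (8 * b + j))
          = nth 1 sg (8 * b + i) * nth 1 tu (8 * b + j) * entry L i j,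
      forall i j, (i < 8 * K)%N -> (j < 8 * K)%N ->
        B (nth x0 rs i) (nth x0 cs j) != 0 -> (i %/ 8 = j %/ 8)%N
    & forall k j, B k j != 0 -> (k \in rs) = (j \in cs)].

Lemma sign_neq0 (e : int) : e = 1 \/ e = -1 -> e != 0.
Proof. by case=> ->. Qed.

(** The extracted part is closed under nonzero entries and the new pattern is connected, so one row
    [m] outside [rs] puts the whole new copy outside. *)
Lemma partial_blocks_append x0 K rs cs sg tu m L rs1 cs1 sg1 tu1 :
  partial_blocks x0 K rs cs sg tu -> L = rows1 \/ L = rows2 ->
  embeds_block m L rs1 cs1 sg1 tu1 -> m \in rs1 -> m \notin rs ->
  partial_blocks x0 K.+1 (rs ++ rs1) (cs ++ cs1) (sg ++ sg1) (tu ++ tu1).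
Proof.
move=> [[urs ucs rsK csK] [sgK tuK sgP tuP] Hblk Hdiag Hclo] HL.
move=> [[urs1 ucs1 rs8 cs8] [sg8 tu8 sgP1 tuP1] Hent Hclo1] mrs1 mrs.
have Hent0 i j : (i < 8)%N -> (j < 8)%N ->
    B (nth x0 rs1 i) (nth x0 cs1 j) = nth 1 sg1 i * nth 1 tu1 j * entry L i j.
  move=> i8 j8; rewrite -Hent // (set_nth_default m x0) ?rs8 //.
  by rewrite (set_nth_default m x0) ?cs8.
have Hconn := @block_connected L (fun i => nth x0 rs1 i \in rs)
  (fun j => nth x0 cs1 j \in cs) HL.
have {}Hconn : forall i, (i < 8)%N ->
    (nth x0 rs1 i \in rs) = (nth x0 rs1 0 \in rs) /\
    (nth x0 cs1 i \in cs) = (nth x0 rs1 0 \in rs).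
  apply: Hconn => i j i8 j8 Lij; apply: Hclo; rewrite Hent0 // !mulf_neq0 //.
    by apply: sign_neq0; apply: sgP1; rewrite mem_nth ?sg8.
  by apply: sign_neq0; apply: tuP1; rewrite mem_nth ?tu8.
have out0 : nth x0 rs1 0 \notin rs.
  case/(nthP x0): mrs1 => i; rewrite rs8 => /Hconn[+ _] im.
  by rewrite im => <-.
have outr k : k \in rs1 -> k \notin rs.
  by case/(nthP x0)=> i; rewrite rs8 => /Hconn[Hi _] <-; rewrite Hi.
have outc k : k \in cs1 -> k \notin cs.
  by case/(nthP x0)=> i; rewrite cs8 => /Hconn[_ Hi] <-; rewrite Hi.
split.
- rewrite !cat_uniq !size_cat urs ucs urs1 ucs1 rsK csK rs8 cs8 !andbT.
  by split; rewrite ?mulnSr //; apply/hasPn => k; [apply: outr|apply: outc].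
- rewrite !size_cat sgK tuK sg8 tu8 -mulnSr; split=> // e.
    by rewrite mem_cat => /orP[/sgP|/sgP1].
  by rewrite mem_cat => /orP[/tuP|/tuP1].
- move=> b; rewrite ltnS leq_eqVlt => /orP[/eqP->|bK].
    exists L => // i j i8 j8; rewrite !nth_cat rsK csK sgK tuK.
    by rewrite !ltnNge !leq_addr /= !addKn Hent0.
  have [L' HL' Hb] := Hblk b bK; exists L' => // i j i8 j8.
  rewrite !nth_cat rsK csK sgK tuK.
  have -> : (8 * b + i < 8 * K)%N by lia.
  have -> : (8 * b + j < 8 * K)%N by lia.
  exact: Hb.
- move=> i j iK jK; rewrite !nth_cat rsK csK.
  case: ltnP => iK'; case: ltnP => jK'.
  + exact: Hdiag.
  + have jc : (j - 8 * K < size cs1)%N by rewrite cs8; lia.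
    by move/Hclo; rewrite mem_nth ?rsK // (negPf (outc _ (mem_nth x0 jc))).
  + have ir : (i - 8 * K < size rs1)%N by rewrite rs8; lia.
    move/Hclo; rewrite [RHS]mem_nth ?csK //.
    by rewrite (negPf (outr _ (mem_nth x0 ir))).
  + by move=> _; lia.
- by move=> k j kj; rewrite !mem_cat (Hclo _ _ kj) (Hclo1 _ _ kj).
Qed.

(** Induction on a bound [N] for the number of rows left. A remaining row meeting a column of norm
    other than 4 is exceptional and yields a further copy; this uses up eight rows, so [N] drops by
    at least one. *)
Lemma exists_maximal_blocks x0 : exists K rs cs sg tu,
  partial_blocks x0 K rs cs sg tu /\
  forall k j, k \notin rs -> B k j != 0 -> norm j = 4%N.
Proof.
have step N : forall K rs cs sg tu, partial_blocks x0 K rs cs sg tu ->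
    (n <= 8 * K + N)%N -> exists K rs cs sg tu,
      partial_blocks x0 K rs cs sg tu /\
      forall k j, k \notin rs -> B k j != 0 -> norm j = 4%N.
  elim: N => [|N IH] K rs cs sg tu HP leN.
    exists K, rs, cs, sg, tu; split=> // k j krs _; case: HP => [[urs _ rsK _] _ _ _ _].
    have : (#|k :: rs| <= #|'I_n|)%N by apply: max_card.
    by rewrite (card_uniqP _) /= ?krs // rsK card_ord; lia.
  have [/existsP[k /andP[krs /existsP[j /andP[kj nj]]]]|H] :=
    boolP [exists k, (k \notin rs) && [exists j, (B k j != 0) && (norm j != 4%N)]].
    have [x [y [z [w [Hk types]]]]] := row_types k.
    have [L [HL [rs1 [cs1 [sg1 [tu1 [krs1 Hblk]]]]]]] : exists L,
        (L = rows1 \/ L = rows2) /\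
        exists rs1 cs1 sg1 tu1, k \in rs1 /\ embeds_block k L rs1 cs1 sg1 tu1.
      case: types => [][nx ny nz nw].
      - move: kj nj; rewrite Hk.2 !inE => /or4P[]/eqP->;
        by rewrite ?nx ?ny ?nz ?nw.
      - by exists rows1; split; [left | apply: type1_block Hk _ _ _ _].
      - by exists rows2; split; [right | apply: type2_block Hk _ _ _ _].
    apply: (IH K.+1 _ _ _ _ (partial_blocks_append HP HL Hblk krs1 krs)).
    by lia.
  exists K, rs, cs, sg, tu; split=> // k j krs kj.
  move: H; rewrite negb_exists => /forallP/(_ k); rewrite krs /= negb_exists.
  by move/forallP/(_ j); rewrite kj /= negbK => /eqP.
apply: (step n 0%N [::] [::] [::] [::]); last by rewrite muln0.
by split.
Qed.

(** An ordering of all indices that starts with [s]; it becomes the row or column permutation that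
    moves the copies to the front. *)
Definition complete_seq (s : seq 'I_n) := s ++ [seq k <- enum 'I_n | k \notin s].

Lemma complete_seq_uniq s : uniq s -> uniq (complete_seq s).
Proof.
move=> us; rewrite cat_uniq us filter_uniq ?enum_uniq // andbT /=.
by apply/hasPn => k; rewrite mem_filter => /andP[].
Qed.

Lemma complete_seq_size s : uniq s -> size (complete_seq s) = n.
Proof.
move=> us; rewrite -(card_uniqP (complete_seq_uniq us)) -[RHS]card_ord.
apply: eq_card => k; rewrite mem_cat mem_filter mem_enum andbT !inE.
by case: (k \in s).
Qed.

Lemma complete_seq_mem x0 s (i : 'I_n) : uniq s ->
  (nth x0 (complete_seq s) i \in s) = (i < size s)%N.
Proof.
move=> us; rewrite nth_cat; case: ltnP => is_; first by rewrite mem_nth.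
apply/negbTE; have : (i < size (complete_seq s))%N by rewrite complete_seq_size.
rewrite size_cat => lti.
have : nth x0 [seq k <- enum 'I_n | k \notin s] (i - size s)
    \in [seq k <- enum 'I_n | k \notin s].
  by rewrite mem_nth // ltn_subLR.
by rewrite mem_filter => /andP[].
Qed.

Lemma complete_seq_inj x0 s : uniq s ->
  injective (fun i : 'I_n => nth x0 (complete_seq s) i).
Proof.
move=> us i j /eqP; rewrite nth_uniq ?complete_seq_size ?complete_seq_uniq //.
by move/eqP/val_inj.
Qed.

Lemma unit_block_diagonal (x0 : 'I_n) :
  exists B' : 'M[int]_n, signed_equiv B B' /\ good_block_diagonal B'.
Proof.
have [K [rs [cs [sg [tu [HP Hrest]]]]]] := exists_maximal_blocks x0.
case: HP => [[urs ucs rsK csK] [sgK tuK sgP tuP] Hblk Hdiag Hclo].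
pose s := perm (@complete_seq_inj x0 rs urs).
pose t := perm (@complete_seq_inj x0 cs ucs).
have sE i : s i = nth x0 (complete_seq rs) i by rewrite permE.
have tE i : t i = nth x0 (complete_seq cs) i by rewrite permE.
(* The default 1 of [nth] gives the rows beyond the copies the sign 1; likewise for columns. *)
have sg_sign (i : 'I_n) : nth 1 sg i = 1 \/ nth 1 sg i = -1.
  case: (ltnP i (size sg)) => isg; first by apply/sgP/mem_nth.
  by left; rewrite nth_default.
have tu_sign (i : 'I_n) : nth 1 tu i = 1 \/ nth 1 tu i = -1.
  case: (ltnP i (size tu)) => itu; first by apply/tuP/mem_nth.
  by left; rewrite nth_default.
pose B' : 'M[int]_n := \matrix_(i, j) (nth 1 sg i * nth 1 tu j * B (s i) (t j)).
have B'E i j : B' i j = nth 1 sg i * nth 1 tu j * B (s i) (t j) by rewrite mxE.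
have B'0 i j : (B' i j != 0) = (B (s i) (t j) != 0).
  by rewrite B'E; case: (sg_sign i) => ->; case: (tu_sign j) => ->;
    rewrite ?mulrN ?mulNr ?mul1r ?opprK ?oppr_eq0.
have s_lt i : (s i \in rs) = (i < 8 * K)%N by rewrite sE complete_seq_mem // rsK.
have t_lt i : (t i \in cs) = (i < 8 * K)%N by rewrite tE complete_seq_mem // csK.
have s_nth (i : 'I_n) : (i < 8 * K)%N -> s i = nth x0 rs i.
  by move=> iK; rewrite sE nth_cat rsK iK.
have t_nth (i : 'I_n) : (i < 8 * K)%N -> t i = nth x0 cs i.
  by move=> iK; rewrite tE nth_cat csK iK.
have leKn : (8 * K <= n)%N.
  by have := complete_seq_size urs; rewrite size_cat rsK => E; rewrite -[leqRHS]E leq_addr.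
(* The copies get the labels below [K], and the cap at [K] merges everything after them into a
   single block. *)
pose f (i : 'I_n) := minn (i %/ 8) K.
exists B'; split.
  exists s, t, (fun i => nth 1 sg i), (fun j => nth 1 tu j).
  by split; [exact: sg_sign | split; [exact: tu_sign | exact: B'E]].
have Hlab : block_labelling B' f.
  split=> [i j ij|i j].
    by rewrite /f; have := leq_div2r 8 ij; lia.
  rewrite B'0 => Bij; have := Hclo _ _ Bij; rewrite s_lt t_lt => E.
  have [iK|iK] := ltnP i (8 * K).
    have jK : (j < 8 * K)%N by rewrite -E.
    by rewrite /f (Hdiag i j) // -s_nth // -t_nth.
  have jK : (8 * K <= j)%N by rewrite leqNgt -E -leqNgt.
  by rewrite /f; lia.
exists f; split=> // l [i0 fi0].
have leK : (l <= K)%N by rewrite -fi0 geq_minr.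
move: leK; rewrite leq_eqVlt => /orP[/eqP lK|lK]; last first.
  have fP (i : 'I_n) : (f i == l) = (8 * l <= i < 8 * l + 8)%N.
    by rewrite /f; lia.
  have [L HL Hb] := Hblk l lK.
  have Hcard : #|[set i : 'I_n | f i == l]| = 8%N.
    pose g (u : 'I_8) : 'I_n := insubd x0 (8 * l + u)%N.
    have gE u : val (g u) = (8 * l + u)%N.
      have lt_n : (8 * l + u < n)%N by have := ltn_ord u; lia.
      by rewrite val_insubd lt_n.
    have ginj : injective g.
      by move=> u v /(congr1 val); rewrite !gE => /addnI/val_inj.
    rewrite -[RHS]card_ord -(card_imset _ ginj); apply: eq_card => i.
    rewrite inE fP; apply/idP/imsetP => [Hi|[u _ ->]].
      have ui : (i - 8 * l < 8)%N by lia.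
      by exists (Ordinal ui) => //; apply: val_inj; rewrite gE /=; lia.
    by rewrite gE leq_addr ltn_add2l ltn_ord.
  have Hmx (M : 'M[int]_8) : M = mx_of_rows L -> block_is B' f l M.
    move=> ->; split=> //; exists (8 * l)%N; split=> [i /eqP|i j /eqP fi /eqP fj].
      by rewrite fP.
    move: fi fj; rewrite !fP => fi fj.
    have i8 : (i - 8 * l < 8)%N by lia.
    have j8 : (j - 8 * l < 8)%N by lia.
    rewrite B'E s_nth ?t_nth; [|lia|lia].
    have Ei : (8 * l + (i - 8 * l) = i)%N by lia.
    have Ej : (8 * l + (j - 8 * l) = j)%N by lia.
    have := Hb _ _ i8 j8; rewrite Ei Ej => ->.
    rewrite mxE !inordK // -/(entry L _ _).
    by case: (sg_sign i) => ->; case: (tu_sign j) => ->; ring.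
  by case: HL => HL; [left | right; left]; apply: Hmx; rewrite HL.
right; right; rewrite lK => j fj.
have jK : (8 * K <= j)%N by move: fj; rewrite /f; lia.
(* Any row meeting this column lies outside the copies because the column does, so maximality gives
   norm 4. *)
have [k kt _] := @new_row (t j) [::] (norm_gt0 (t j)).
have nt : norm (t j) = 4%N.
  by apply: (Hrest k _ _ kt); rewrite (Hclo _ _ kt) t_lt -leqNgt.
split=> [|i _].
  rewrite -nt /norm -(card_preimset (colset (t j)) (@perm_inj _ s)).
  apply: eq_card => i; rewrite !inE -B'0; apply/andb_idl => ij.
  by rewrite (Hlab.2 _ _ ij) fj.
rewrite B'0 B'E => /nz_sign Bij.
by apply: sign_mul => //; apply: sign_mul.
Qed.

End UnitEntries.

(** * Reduction to matrices with entries 0, 1 and -1 *)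

Lemma sqrz_ge_neq0 (x : int) : 0 <= x * x - (x != 0)%:Z.
Proof.
have [->//|x0] := eqVneq x 0; rewrite subr_ge0 /=.
have [xl|xg] : x <= -1 \/ 1 <= x by lia.
  by nia.
by nia.
Qed.

Lemma sqrz_eq_neq0 (x : int) : x * x - (x != 0)%:Z = 0 -> -1 <= x <= 1.
Proof.
have [->//|x0] := eqVneq x 0; move=> /= /eqP; rewrite subr_eq0 -expr2 sqrf_eq1.
by case/orP=> /eqP->.
Qed.

Theorem theorem3p1 (n : nat) (B : 'M[int]_n) :
  orthogonal_cols B ->
  pcount B 4 = n ->
  Iinv B = n%:Z ->
  exists B' : 'M[int]_n, signed_equiv B B' /\ good_block_diagonal B'.
Proof.
move=> orthB p4 IB.
have row4 i : #|Erow B i| = 4%N.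
  have /eqP E : [set j : 'I_n | #|Erow B j| == 4%N] == [set: 'I_n].
    by rewrite eqEcard subsetT cardsT card_ord -[X in (X <= _)%N]p4 leqnn.
  by have := in_setT i; rewrite -E inE => /eqP.
have unitB i j : -1 <= B i j <= 1.
  have sq_ge k l : 0 <= B k l * B k l - (B k l != 0)%:Z by apply: sqrz_ge_neq0.
  (* [Iinv B = n] makes the squared entries sum to 4n, which is also the number of nonzero entries.
     The difference is a sum of nonnegative terms, so each term vanishes. *)
  have S0 : \sum_k \sum_l (B k l * B k l - (B k l != 0)%:Z) = 0.
    have -> : \sum_k \sum_l (B k l * B k l - (B k l != 0)%:Z) =
        \sum_k \sum_l B k l * B k l - \sum_(k < n) 4.
      rewrite -sumrB; apply: eq_bigr => k _; rewrite sumrB; congr (_ - _).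
      rewrite -[RHS]/(4%:Z) -(row4 k) -sum1_card -[RHS]natz natr_sum [RHS]big_mkcond /=.
      by apply: eq_bigr => l _; rewrite inE; case: eqP.
    rewrite sumr_const card_ord; apply/eqP; rewrite subr_eq0; apply/eqP.
    have : Iinv B = \sum_k \sum_l B k l * B k l - 3 *+ n.
      by rewrite /Iinv sumrB sumr_const card_ord exchange_big.
    by move/esym/eqP; rewrite subr_eq IB -natz -mulrnDl => /eqP.
  have /psumr_eq0P R0 := S0; have := R0 (fun k _ => sumr_ge0 _ (fun l _ => sq_ge k l)) i isT.
  move/psumr_eq0P => /(_ (fun l _ => sq_ge i l)) /(_ j isT).
  exact: sqrz_eq_neq0.
(* The empty matrix is treated apart because the block construction needs an index as default value
   for [nth]. *)
case: n B orthB p4 IB row4 unitB => [|n] B orthB _ _ row4 unitB; last first.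
  exact: unit_block_diagonal orthB unitB row4 ord0.
exists B; split.
  by exists 1%g, 1%g, (fun=> 1), (fun=> 1); split; [auto | split; [auto | case]].
by exists (fun=> 0%N); split=> [|l [[]]] //; split=> // [[]].
Qed.
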